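(* Let $n\ge1$ be an integer and, for $f\in C(\triangle_H)$, define $$\mathcal L_n^*f(\mathbf t)=\sum_{\mathbf j\in\Lambda_n}f(\tfrac{\mathbf j}{4n})\,\ell^\triangle_{\mathbf j,n}(\mathbf t),\qquad \ell^\triangle_{\mathbf j,n}(\mathbf t)=\frac{\lambda^{(n)}_{\mathbf j}}{4n^3}\sum_{\mathbf k\in\Lambda_n}\lambda^{(n)}_{\mathbf k}\mathsf{TC}_{\mathbf k}(\mathbf t)\overline{\mathsf{TC}_{\mathbf k}(\tfrac{\mathbf j}{4n})}.$$ Then $\mathcal L_n^*f$ is the unique function in $\mathcal{TC}_n$ satisfying $\mathcal L_n^*f(\tfrac{\mathbf j}{4n})=f(\tfrac{\mathbf j}{4n})$ for all $\mathbf j\in\Lambda_n$. Furthermore, $$\ell^\triangle_{\mathbf j,n}(\mathbf t)=\lambda^{(n)}_{\mathbf j}\,\mathcal P^+\ell_{\mathbf j,n}(\mathbf t),\qquad\text{where } \ell_{\mathbf j,n}(\mathbf t)=\Phi_n^*(\mathbf t-\tfrac{\mathbf j}{4n}).$$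
   Context: Let $\mathbb R^4_H=\{\mathbf t\in\mathbb R^4: t_1+t_2+t_3+t_4=0\}$, $\mathbb Z^4_H=\mathbb Z^4\cap\mathbb R^4_H$, $\mathbb H=\{\mathbf k\in\mathbb Z^4_H: k_1\equiv k_2\equiv k_3\equiv k_4\pmod4\}$, $\phi_{\mathbf k}(\mathbf t)=e^{\frac{\pi i}{2}\mathbf k\cdot\mathbf t}$. Let $\mathcal G=S_4$ act on $\mathbf t$ by permuting coordinates, $\mathbf t\mapsto\mathbf t\sigma$; $\mathcal P^+f(\mathbf t)=\frac1{24}\sum_{\sigma\in\mathcal G}f(\mathbf t\sigma)$ and $\mathsf{TC}_{\mathbf k}=\mathcal P^+\phi_{\mathbf k}$. Let $\triangle_H=\{\mathbf t\in\mathbb R^4_H: t_1-t_2,\,t_2-t_3,\,t_3-t_4,\,t_1-t_4\in[0,1]\}$, $\Lambda_n=\{\mathbf k\in\mathbb H: k_4\le k_3\le k_2\le k_1\le k_4+4n\}$, $\mathcal{TC}_n=\operatorname{span}\{\mathsf{TC}_{\mathbf k}:\mathbf k\in\Lambda_n\}$. For $\mathbf j\in\Lambda_n$ consider the relations (a) $j_1=j_2$, (b) $j_2=j_3$, (c) $j_3=j_4$, (d) $j_1=j_4+4n$; $\lambda^{(n)}_{\mathbf j}=24$ if none holds, $12$ if exactly one holds, $6$ if exactly two hold and they are $\{(a),(c)\}$ or $\{(b),(d)\}$, $4$ if exactly two other ones hold, and $1$ if three hold. Let $\mathbb H_n^*=\{\mathbf k\in\mathbb H: -4n\le k_i-k_j\le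 4n,\ i<j\}$; for $\mathbf k\in\mathbb H_n^*$, $c^{(n)}_{\mathbf k}=1$ if $\max_ik_i-\min_ik_i<4n$ and otherwise $c^{(n)}_{\mathbf k}=1/\binom{p+q}{p}$ with $p$ (resp. $q$) the number of coordinates equal to $\max_ik_i$ (resp. $\min_ik_i$). Finally $\Phi_n^*(\mathbf t)=\frac1{4n^3}\sum_{\mathbf k\in\mathbb H_n^*}c^{(n)}_{\mathbf k}\phi_{\mathbf k}(\mathbf t)$. *)

(* Defs.v *)
From HB Require Import structures.
From mathcomp Require Import all_boot all_order all_algebra all_fingroup.
From mathcomp Require Import complex.
From mathcomp Require Import reals trigo.
Set Implicit Arguments. Unset Strict Implicit. Unset Printing Implicit Defensive.
Import Order.TTheory GRing.Theory Num.Theory.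
Local Open Scope ring_scope.
Local Open Scope complex_scope.

(* the four coordinates indices 0,1,2,3 (paper's 1,2,3,4) *)
Definition o0 : 'I_4 := @Ordinal 4 0 isT.
Definition o1 : 'I_4 := @Ordinal 4 1 isT.
Definition o2 : 'I_4 := @Ordinal 4 2 isT.
Definition o3 : 'I_4 := @Ordinal 4 3 isT.

Definition ivec := {ffun 'I_4 -> int}.

(* box [-4n,4n]^4 as a finite type, and its embedding into Z^4.
   Every element of Lambda_n and of H_n^* lies in this box, so sums over
   Lambda_n / H_n^* are written as filtered sums over the box. *)
Definition box (n : nat) := {ffun 'I_4 -> 'I_(8 * n + 1)}.
Definition ofbox (n : nat) (u : box n) : ivec :=
  [ffun i => (u i)%:Z - (4 * n)%:Z].

Definition inH (k : ivec) : bool :=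
  (\sum_(i < 4) k i == 0) && [forall i : 'I_4, (4 %| k i - k o0)%Z].

Definition inLambda (n : nat) (k : ivec) : bool :=
  [&& inH k, k o3 <= k o2, k o2 <= k o1, k o1 <= k o0 & k o0 <= k o3 + (4 * n)%:Z].

Definition inHstar (n : nat) (k : ivec) : bool :=
  inH k && [forall i : 'I_4, forall j : 'I_4,
              (i < j)%N ==> ((- (4 * n)%:Z <= k i - k j) && (k i - k j <= (4 * n)%:Z))].

Definition rvec (R : realType) := 'I_4 -> R.
Definition inRH (R : realType) (t : rvec R) : Prop := \sum_(i < 4) t i = 0.

Definition inTri (R : realType) (t : rvec R) : Prop :=
  inRH t /\ 0 <= t o0 - t o1 <= 1 /\ 0 <= t o1 - t o2 <= 1 /\ 0 <= t o2 - t o3 <= 1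
  /\ 0 <= t o0 - t o3 <= 1.

Definition continuous_on_tri (R : realType) (f : rvec R -> R[i]) : Prop :=
  forall t, inTri t -> forall e : R, 0 < e -> exists2 d : R, 0 < d &
    forall s, inTri s -> (forall i, `|s i - t i| < d) -> `|f s - f t| < e%:C.

Definition node (R : realType) (n : nat) (j : ivec) : rvec R :=
  fun i => (j i)%:~R / (4 * n)%:R.

Definition vsub (R : realType) (t s : rvec R) : rvec R := fun i => t i - s i.

Definition cexpi (R : realType) (x : R) : R[i] := cos x +i* sin x.
Definition phi (R : realType) (k : ivec) (t : rvec R) : R[i] :=
  cexpi (pi / 2 * \sum_(i < 4) (k i)%:~R * t i).

Definition Pplus (R : realType) (f : rvec R -> R[i]) (t : rvec R) : R[i] :=
  (24%:R)^-1 * \sum_(s : 'S_4) f (fun i => t (s i)).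

Definition TC (R : realType) (k : ivec) : rvec R -> R[i] := Pplus (phi k).

Definition inTCn (R : realType) (n : nat) (g : rvec R -> R[i]) : Prop :=
  exists c : ivec -> R[i], forall t, inRH t ->
    g t = \sum_(u : box n | inLambda n (ofbox u)) c (ofbox u) * TC (ofbox u) t.

Definition lambda (R : realType) (n : nat) (j : ivec) : R[i] :=
  let a := j o0 == j o1 in let b := j o1 == j o2 in let c := j o2 == j o3 in
  let d := j o0 == j o3 + (4 * n)%:Z in
  let m := (a + b + c + d)%N in
  if m == 0%N then 24%:R
  else if m == 1%N then 12%:R
  else if m == 2%N then (if (a && c) || (b && d) then 6%:R else 4%:R)
  else 1.

Definition kmax (k : ivec) : int := Num.max (Num.max (k o0) (k o1)) (Num.max (k o2) (k o3)).
Definition kmin (k : ivec) : int := Num.min (Num.min (k o0) (k o1)) (Num.min (k o2) (k o3)).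

Definition cn (R : realType) (n : nat) (k : ivec) : R[i] :=
  if kmax k - kmin k < (4 * n)%:Z then 1
  else let p := #|[pred i : 'I_4 | k i == kmax k]| in
       let q := #|[pred i : 'I_4 | k i == kmin k]| in
       ('C(p + q, p))%:R^-1.

Definition Phistar (R : realType) (n : nat) (t : rvec R) : R[i] :=
  ((4 * n ^ 3)%:R)^-1 *
  \sum_(u : box n | inHstar n (ofbox u)) cn R n (ofbox u) * phi (ofbox u) t.

Definition ell_tri (R : realType) (n : nat) (j : ivec) (t : rvec R) : R[i] :=
  lambda R n j / (4 * n ^ 3)%:R *
  \sum_(u : box n | inLambda n (ofbox u))
     lambda R n (ofbox u) * TC (ofbox u) t * (TC (ofbox u) (node R n j))^*.

Definition ell (R : realType) (n : nat) (j : ivec) (t : rvec R) : R[i] :=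
  Phistar n (vsub t (node R n j)).

Definition Lstar (R : realType) (n : nat) (f : rvec R -> R[i]) (t : rvec R) : R[i] :=
  \sum_(u : box n | inLambda n (ofbox u)) f (node R n (ofbox u)) * ell_tri n (ofbox u) t.

(* Main.v *)
Require Import Defs.
From HB Require Import structures.
From mathcomp Require Import all_boot all_order all_algebra all_fingroup.
From mathcomp Require Import complex.
From mathcomp Require Import reals trigo.
From mathcomp Require Import zify ring lra.
Import Order.TTheory GRing.Theory Num.Theory.
Local Open Scope ring_scope.

(* The nodes and frequencies both live in the finite group H / 4n Z^4_H, of order 4n^3, which is in duality with itself through k.j / 16n.  The affine Weyl group (S_4 acting on this quotient) has Lambda_n as a strict fundamental domain, and lambda_k is the size of the S_4-orbit of k in the quotient.  Hence a sum over the whole group of an S_4-invariant function is the lambda-weighted sum over Lambda_n, and the orthogonality of characters becomes discrete orthogonality of the TC_k on the nodes; this gives interpolation, and, by the symmetry TC_k(j/4n) = TC_j(k/4n), uniqueness.  The compact formula holds because c_k is chosen so that lambda_k = c_k times the size of the genuine S_4-orbit of k, so that the c-weighted sum over H_n^* folds onto Lambda_n for every S_4-invariant function, periodic or not. *)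

(** * Coordinates, permutations and congruence modulo 4n *)

Lemma sum_ord4 (V : nmodType) (F : 'I_4 -> V) :
  \sum_(i < 4) F i = F o0 + F o1 + F o2 + F o3.
Proof.
rewrite !big_ord_recl big_ord0 addr0 !addrA.
by congr (_ + _ + _ + _); congr F; apply: val_inj.
Qed.

Lemma ord4P (P : 'I_4 -> Prop) : P o0 -> P o1 -> P o2 -> P o3 -> forall i, P i.
Proof.
move=> P0 P1 P2 P3 [[|[|[|[|i]]]] Hi] //.
- by rewrite (_ : Ordinal Hi = o0) //; apply: val_inj.
- by rewrite (_ : Ordinal Hi = o1) //; apply: val_inj.
- by rewrite (_ : Ordinal Hi = o2) //; apply: val_inj.
- by rewrite (_ : Ordinal Hi = o3) //; apply: val_inj.
Qed.

Definition permv (k : ivec) (s : 'S_4) : ivec := [ffun i => k (s i)].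

Lemma permv1 k : permv k 1%g = k.
Proof. by apply/ffunP => i; rewrite ffunE perm1. Qed.

Lemma permvM k s t : permv (permv k s) t = permv k (t * s)%g.
Proof. by apply/ffunP => i; rewrite !ffunE permM. Qed.

Definition eqm (n : nat) (x y : ivec) : bool :=
  [forall i, ((4 * n)%:Z %| x i - y i)%Z].

Lemma eqmP n (x y : ivec) :
  reflect (exists v : ivec, forall i, x i = y i + (4 * n)%:Z * v i) (eqm n x y).
Proof.
apply: (iffP forallP) => [H|[v Hv] i]; last first.
  by rewrite Hv addrC addKr dvdz_mulr.
exists [ffun i => ((x i - y i) %/ (4 * n)%:Z)%Z] => i; rewrite ffunE.
by rewrite mulrC divzK // addrC subrK.
Qed.

Lemma eqm_refl n : reflexive (eqm n).
Proof. by move=> x; apply/forallP => i; rewrite subrr dvdz0. Qed.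

Lemma eqm_sym n : symmetric (eqm n).
Proof.
by move=> x y; apply: eq_forallb => i; rewrite -[x i - y i]opprB rpredN.
Qed.

Lemma eqm_trans n : transitive (eqm n).
Proof.
move=> y x z /forallP H1 /forallP H2; apply/forallP => i.
by rewrite -[x i](subrK (y i)) -addrA rpredD // H1 H2.
Qed.

Lemma eqm_permv n x y s : eqm n (permv x s) (permv y s) = eqm n x y.
Proof.
apply/forallP/forallP => H i; last by rewrite !ffunE.
by move: (H ((s^-1)%g i)); rewrite !ffunE permKV.
Qed.

Lemma inHP (k : ivec) :
  reflect (k o0 + k o1 + k o2 + k o3 = 0 /\
           [/\ (4 %| k o1 - k o0)%Z, (4 %| k o2 - k o0)%Z & (4 %| k o3 - k o0)%Z])
          (inH k).
Proof.
rewrite /inH sum_ord4; apply: (iffP andP).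
  by case=> /eqP H /forallP H2; split=> //; split; apply: H2.
case=> -> [H1 H2 H3]; split=> //; apply/forallP.
by apply: ord4P; rewrite ?subrr.
Qed.

Lemma inH_permv k s : inH (permv k s) = inH k.
Proof.
suff H k' s' : inH k' -> inH (permv k' s').
  by apply/idP/idP => [/(H _ (s^-1)%g)|/H//]; rewrite permvM mulVg permv1.
case/andP=> /eqP Hs /forallP Hd; apply/andP; split.
  apply/eqP; rewrite -[RHS]Hs [RHS](reindex_inj (@perm_inj _ s')).
  by apply: eq_bigr => i _; rewrite ffunE.
apply/forallP => i; rewrite !ffunE.
by rewrite -[k' (s' i)](subrK (k' o0)) -addrA rpredD // -opprB rpredN.
Qed.

Lemma inLambdaP n (k : ivec) :
  reflect (inH k /\ [/\ k o3 <= k o2, k o2 <= k o1, k o1 <= k o0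
                      & k o0 <= k o3 + (4 * n)%:Z])
    (inLambda n k).
Proof. by apply: (iffP and5P) => [[]|[] ? []]. Qed.

Lemma inHstarP n (k : ivec) :
  reflect (inH k /\ forall i j, k i - k j <= (4 * n)%:Z) (inHstar n k).
Proof.
apply: (iffP andP) => -[HH H]; split=> //.
  move=> i j; case: (ltngtP i j) => ij.
  - by move/forallP/(_ i)/forallP/(_ j): H; rewrite ij => /andP[].
  - by move/forallP/(_ j)/forallP/(_ i): H; rewrite ij => /andP[]; lia.
  - by rewrite (val_inj ij); lia.
apply/forallP => i; apply/forallP => j; apply/implyP => _.
by move: (H i j) (H j i); lia.
Qed.

Lemma inHstar_permv n k s : inHstar n (permv k s) = inHstar n k.
Proof.
suff H k' s' : inHstar n k' -> inHstar n (permv k' s').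
  by apply/idP/idP => [/(H _ (s^-1)%g)|/H//]; rewrite permvM mulVg permv1.
case/inHstarP => HH H; apply/inHstarP; rewrite inH_permv; split=> // i j.
by rewrite !ffunE.
Qed.

Lemma inLambda_Hstar n k : inLambda n k -> inHstar n k.
Proof.
case/inLambdaP => HH [H1 H2 H3 H4]; apply/inHstarP; split=> //.
by apply: ord4P; apply: ord4P; lia.
Qed.

(** * The alcove as a strict fundamental domain of the affine Weyl group *)

Lemma sort4 (k : ivec) : exists s,
  [/\ permv k s o3 <= permv k s o2, permv k s o2 <= permv k s o1 & permv k s o1 <= permv k s o0].
Proof.
pose srt := sort (fun i j => k j <= k i) (enum 'I_4).
have tot : total (fun i j : 'I_4 => k j <= k i) by move=> i j; exact: le_total.
have ss : sorted (fun i j => k j <= k i) srt by exact: sort_sorted.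
have sz : size srt = 4 by rewrite size_sort size_enum_ord.
have us : uniq srt by rewrite sort_uniq enum_uniq.
have inj : injective (fun i : 'I_4 => nth o0 srt i).
  by move=> i j /eqP; rewrite nth_uniq ?sz // => /eqP /val_inj.
exists (perm inj); rewrite !ffunE !permE /=.
by move: srt ss sz {us inj} => [|a [|b [|c [|d [|? ?]]]]] //= /and4P[-> -> ->].
Qed.

(* [\sum_i floor ((x - k_i) / 4n)] is invariant under the affine Weyl group, and for [k] in the alcove it locates each [k_i]. *)
Definition floor_count (n : nat) (k : ivec) (x : int) : int :=
  \sum_(i < 4) ((x - k i) %/ (4 * n)%:Z)%Z.

Lemma floor_count_permv n k s x : floor_count n (permv k s) x = floor_count n k x.
Proof.
rewrite /floor_count [RHS](reindex_inj (@perm_inj _ s)).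
by apply: eq_bigr => i _; rewrite ffunE.
Qed.

(** Adding 4n [v] lowers the i-th floor by [v i], and equality of the two coordinate sums forces the
    entries of [v] to sum to zero. *)
Lemma floor_count_eqm n k k' x : (0 < n)%N -> inH k -> inH k' -> eqm n k k' ->
  floor_count n k x = floor_count n k' x.
Proof.
move=> n0 /inHP[Hk _] /inHP[Hk' _] /eqmP[v Hv].
have E i : ((x - k i) %/ (4 * n)%:Z)%Z = ((x - k' i) %/ (4 * n)%:Z)%Z - v i.
  rewrite Hv (_ : x - _ = - v i * (4 * n)%:Z + (x - k' i)); last by ring.
  by rewrite divzMDl 1?addrC //; lia.
have Hs : v o0 + v o1 + v o2 + v o3 = 0.
  by move: Hk; rewrite !Hv; nia.
by rewrite /floor_count !sum_ord4 !E; lia.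
Qed.

(** The four quotients increase with the index and the last exceeds the first by at most one, so
    their sum reaches -3, -2, -1, 0 exactly when the quotients of [k o3], [k o2], [k o1], [k o0] in
    turn become nonnegative. *)
Lemma floor_count_alcove n k x : (0 < n)%N -> inLambda n k ->
  [/\ (k o3 <= x) = (- 3 <= floor_count n k x),
      (k o2 <= x) = (- 2 <= floor_count n k x),
      (k o1 <= x) = (- 1 <= floor_count n k x)
    & (k o0 <= x) = (0 <= floor_count n k x)].
Proof.
move=> n0 /inLambdaP[HH [H1 H2 H3 H4]]; rewrite /floor_count sum_ord4.
have N0 : (0 : int) < (4 * n)%:Z by lia.
set N := (4 * n)%:Z in N0 H4 *.
have A a : (0 <= (a %/ N)%Z) = (0 <= a) by rewrite divz_ge0.
have B a : (-1 <= (a %/ N)%Z) = (- N <= a) by rewrite lez_divRL // mulN1r.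
have C a : ((a %/ N)%Z <= 0) = (a < N) by rewrite -ltzD1 ltz_divLR // mul1r.
have := A (x - k o0); have := A (x - k o1); have := A (x - k o2).
have := A (x - k o3); have := B (x - k o0); have := B (x - k o1).
have := B (x - k o2); have := B (x - k o3); have := C (x - k o0).
have := C (x - k o1); have := C (x - k o2); have := C (x - k o3).
have M a b : a <= b -> (a %/ N)%Z <= (b %/ N)%Z by apply: lez_pdiv2r; lia.
have := M (x - k o0) (x - k o1); have := M (x - k o1) (x - k o2).
have := M (x - k o2) (x - k o3).
have := M (x - k o3) (x - k o0 + 1 * N).
rewrite (divzDr (x - k o0)) ?dvdz_mull // mulzK; last by lia.
move: (_ %/ _)%Z (_ %/ _)%Z (_ %/ _)%Z (_ %/ _)%Z => a b c d.
by move=> *; split; lia.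
Qed.

(** Each coordinate of an alcove point is the least [x] at which [floor_count] reaches a fixed
    threshold, so this invariant determines the point. *)
Lemma alcove_uniq n k k' s : (0 < n)%N -> inLambda n k -> inLambda n k' ->
  eqm n k' (permv k s) -> k' = k.
Proof.
move=> n0 Hk Hk' He.
have HH : inH k by case/inLambdaP: Hk.
have HH' : inH k' by case/inLambdaP: Hk'.
have E x : floor_count n k' x = floor_count n k x.
  by rewrite -(floor_count_permv n k s); apply: floor_count_eqm; rewrite ?inH_permv.
have eqi (a b : int) : (forall x, (a <= x) = (b <= x)) -> a = b.
  by move=> H; move: (H a) (H b); lia.
apply/ffunP; apply: ord4P; apply: eqi => x;
  case: (floor_count_alcove n k x n0 Hk) => e3 e2 e1 e0;
  case: (floor_count_alcove n k' x n0 Hk') => f3 f2 f1 f0;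
  by rewrite ?(e0, e1, e2, e3) ?(f0, f1, f2, f3) E.
Qed.

Definition mk4 (a b c d : int) : ivec := [ffun i : 'I_4 => nth 0 [:: a; b; c; d] i].

(** Addition of 1 in Z/4. Composing a sorted vector with it moves the largest coordinate to the end,
    its place once it is lowered by 4n. *)
Definition cyc : 'S_4 := perm (@addrI 'I_4 1).

(* After reducing mod 4n and sorting, the coordinates sum to 4nw with 0 <= w < 4; lowering the w largest ones by 4n gives an alcove point up to a cyclic shift. *)
Lemma alcove_exists n x : (0 < n)%N -> inH x ->
  exists s, exists2 k, inLambda n k & eqm n k (permv x s).
Proof.
move=> n0 Hx.
pose y : ivec := [ffun i => (x i %% (4 * n)%:Z)%Z].
have N0 : (0 : int) < (4 * n)%:Z by lia.
have eyx : eqm n y x.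
  apply/forallP => i; rewrite ffunE -opprB rpredN {1}(divz_eq (x i) (4 * n)%:Z).
  by rewrite addrK dvdz_mull.
have y_ge0 i : 0 <= y i by rewrite ffunE modz_ge0 //; lia.
have y_lt i : y i < (4 * n)%:Z by rewrite ffunE ltz_pmod.
have [s [S1 S2 S3]] := sort4 y.
have {}eyx : eqm n (permv y s) (permv x s) by rewrite eqm_permv.
have {}Hx : inH (permv x s) by rewrite inH_permv.
have {}y_ge0 i : 0 <= permv y s i by rewrite ffunE.
have {}y_lt i : permv y s i < (4 * n)%:Z by rewrite ffunE.
(* Recorded before generalizing, so that the permutation found for [x'] can be composed with the
   sorting one. *)
have xsM := permvM x s.
move: (permv x s) (permv y s) Hx eyx y_ge0 y_lt S1 S2 S3 xsM => x' z Hx ezx z0 zN S1 S2 S3 xsM.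
suff [t [k Hk He]] : exists t, exists2 k, inLambda n k & eqm n k (permv x' t).
  by exists (t * s)%g, k; rewrite -?xsM.
have [v Hv] := eqmP _ _ _ ezx.
case/inHP: Hx => Hx [X1 X2 X3].
have Hz : z o0 + z o1 + z o2 + z o3 = (4 * n)%:Z * (v o0 + v o1 + v o2 + v o3).
  by rewrite !Hv; nia.
have [Z1 Z2 Z3] : [/\ (4 %| z o1 - z o0)%Z, (4 %| z o2 - z o0)%Z & (4 %| z o3 - z o0)%Z].
  by rewrite !Hv; split; lia.
move: (v o0 + v o1 + v o2 + v o3) Hz => w Hz.
have [w0 w4] : 0 <= w /\ w < 4.
  by move: (z0 o0) (z0 o1) (z0 o2) (z0 o3) (zN o0) (zN o1) (zN o2) (zN o3); split; nia.
have F t k : eqm n k (permv z t) -> eqm n k (permv x' t).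
  by move=> h; apply: eqm_trans h _; rewrite eqm_permv.
move: (z0 o3) (zN o0) => b3 b0.
have dv0 (a : int) : ((4 * n)%:Z %| a - a)%Z by rewrite subrr dvdz0.
have dvN (a : int) : ((4 * n)%:Z %| a - (4 * n)%:Z - a)%Z.
  by rewrite addrAC subrr add0r rpredN dvdzz.
have hw : w = 0 \/ w = 1 \/ w = 2 \/ w = 3 by lia.
have cE t : t = cyc -> [/\ t o0 = o1, t o1 = o2, t o2 = o3 & t o3 = o0].
  by move=> ->; split; rewrite permE; apply: val_inj.
have [c0 c1 c2 c3] := cE _ erefl.
case: hw => [hw|[hw|[hw|hw]]]; subst w.
- exists (1 : 'S_4)%g, z; last by apply: F; rewrite permv1 eqm_refl.
  by apply/inLambdaP; split; [apply/inHP; split; [lia | split=> //] | split; lia].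
- exists cyc, (mk4 (z o1) (z o2) (z o3) (z o0 - (4 * n)%:Z)).
    apply/inLambdaP; split; [apply/inHP; split; last split|split];
      rewrite !ffunE /=; lia.
  apply: F; apply/forallP; apply: ord4P; rewrite !ffunE /= ?(c0, c1, c2, c3) ?dv0 ?dvN //.
- exists (cyc * cyc)%g, (mk4 (z o2) (z o3) (z o0 - (4 * n)%:Z) (z o1 - (4 * n)%:Z)).
    apply/inLambdaP; split; [apply/inHP; split; last split|split];
      rewrite !ffunE /=; lia.
  apply: F; apply/forallP; apply: ord4P; rewrite !ffunE !permM /= ?(c0, c1, c2, c3) ?dv0 ?dvN //.
- exists (cyc * cyc * cyc)%g, (mk4 (z o3) (z o0 - (4 * n)%:Z) (z o1 - (4 * n)%:Z) (z o2 - (4 * n)%:Z)).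
    apply/inLambdaP; split; [apply/inHP; split; last split|split];
      rewrite !ffunE /=; lia.
  apply: F; apply/forallP; apply: ord4P; rewrite !ffunE !permM /= ?(c0, c1, c2, c3) ?dv0 ?dvN //.
Qed.

(** * Stabilizers, [lambda] and [c] *)

(** Replaces a count over ['S_4] by one over 24 explicit words, which can be evaluated. *)
Lemma card_S4 (E : nat -> nat -> bool) :
  #|[pred s : 'S_4 | [forall i : 'I_4, E i (s i)]]| =
  count (fun l => [&& E 0 (nth 0 l 0), E 1 (nth 0 l 1), E 2 (nth 0 l 2) & E 3 (nth 0 l 3)])%N
    (permutations (iota 0 4)).
Proof.
pose w (s : 'S_4) := [seq val (s i) | i <- [:: o0; o1; o2; o3]].
have w_inj : injective w.
  move=> s t [] /val_inj e0 /val_inj e1 /val_inj e2 /val_inj e3.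
  by apply/permP; apply: ord4P.
have w_mem s : w s \in permutations (iota 0 4).
  have u : uniq (w s) by rewrite map_inj_uniq // => i j /val_inj /perm_inj.
  rewrite mem_permutations uniq_perm ?iota_uniq // => x.
  have sub : {subset w s <= iota 0 4}.
    by move=> _ /mapP[i _ ->]; rewrite mem_iota ltn_ord.
  by have [] := uniq_min_size u sub isT.
(* The words of the 24 permutations are distinct, hence exhaust a list of length 24. *)
have p : perm_eq [seq w s | s <- enum 'S_4] (permutations (iota 0 4)).
  have u : uniq [seq w s | s <- enum 'S_4] by rewrite map_inj_uniq ?enum_uniq.
  rewrite uniq_perm ?permutations_uniq // => x.
  have sub : {subset [seq w s | s <- enum 'S_4] <= permutations (iota 0 4)}.
    by move=> _ /mapP[s _ ->].
  have [] // := uniq_min_size u sub.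
  by rewrite size_map -cardE card_Sn size_permutations ?iota_uniq.
rewrite -(seq.permP p) count_map cardE enumT size_filter -enumT.
apply: eq_count => s /=.
apply/forallP/and4P => [H|[H0 H1 H2 H3]].
  by split; [apply: (H o0)|apply: (H o1)|apply: (H o2)|apply: (H o3)].
exact: ord4P.
Qed.

(** The relation is a parameter because two stabilizers are compared: that of the class modulo 4n
    ([eqm n]) and that of the vector itself ([eq_op]). *)
Definition stab (e : rel ivec) (k : ivec) : nat := #|[pred s : 'S_4 | e k (permv k s)]|.

(* Coordinates [i] and [j] of an alcove point agree mod 4n iff the relations (a)-(d), seen as the edges of a 4-cycle, connect [i] to [j]; without (d) they are then equal. *)
Definition chain (a b c : bool) (i j : nat) : bool :=
  all (nth true [:: a; b; c]) (iota i (j - i)).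

(** The two disjuncts are the two arcs of the 4-cycle between [i] and [j], without and with the edge
    (d). *)
Definition linked (a b c d : bool) (i j : nat) : bool :=
  let lo := minn i j in let hi := maxn i j in
  chain a b c lo hi || [&& d, chain a b c 0 lo & chain a b c hi 3].

Lemma dvdz_between (N D : int) : 0 < N -> 0 <= D <= N ->
  (N %| D)%Z = (D == 0) || (D == N).
Proof.
move=> N0 /andP[D0 DN]; apply/idP/orP => [/dvdzP[q Hq]|[]/eqP->]; rewrite ?dvdz0 ?dvdzz //.
have [q0 q1] : 0 <= q /\ q <= 1 by split; nia.
have [?|?] : q = 0 \/ q = 1 by lia.
  by left; rewrite Hq; apply/eqP; lia.
by right; rewrite Hq; apply/eqP; lia.
Qed.

(** For [i] before [j] the difference lies between 0 and 4n. It is 0 when all consecutive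
    coordinates between them tie, and 4n when (d) holds and the outer coordinates tie. *)
Lemma linked_eqm n k : (0 < n)%N -> inLambda n k -> forall i j : 'I_4,
  ((4 * n)%:Z %| k i - k j)%Z =
  linked (k o0 == k o1) (k o1 == k o2) (k o2 == k o3) (k o0 == k o3 + (4 * n)%:Z) i j.
Proof.
move=> n0 /inLambdaP[_ [H1 H2 H3 H4]].
have N0 : (0 : int) < (4 * n)%:Z by lia.
have dvdC i j : ((4 * n)%:Z %| k i - k j)%Z = ((4 * n)%:Z %| k j - k i)%Z.
  by rewrite -[k j - k i]opprB rpredN.
apply: ord4P; apply: ord4P; rewrite /linked /chain /= ?subrr ?dvdz0 ?andbT //.
all: first [rewrite dvdz_between; lia | rewrite dvdC dvdz_between; lia].
Qed.

Lemma linked_eq n k : inLambda n k -> forall i j : 'I_4,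
  (k i == k j) = linked (k o0 == k o1) (k o1 == k o2) (k o2 == k o3) false i j.
Proof.
move=> /inLambdaP[_ [H1 H2 H3 H4]].
by apply: ord4P; apply: ord4P; rewrite /linked /chain /= ?eqxx //; lia.
Qed.

Definition nlinked (a b c d : bool) : nat :=
  count (fun l => [&& linked a b c d 0 (nth 0 l 0), linked a b c d 1 (nth 0 l 1),
                      linked a b c d 2 (nth 0 l 2) & linked a b c d 3 (nth 0 l 3)])%N
    (permutations (iota 0 4)).

Lemma stab_linked (e : rel ivec) k a b c d :
  (forall s, e k (permv k s) = [forall i : 'I_4, linked a b c d i (s i)]) ->
  stab e k = nlinked a b c d.
Proof.
by move=> He; rewrite /nlinked -card_S4; apply: eq_card => s; rewrite !inE He.
Qed.

Definition nlambda (a b c d : bool) : nat :=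
  let m := (a + b + c + d)%N in
  if m == 0%N then 24 else if m == 1%N then 12
  else if m == 2%N then (if (a && c) || (b && d) then 6 else 4) else 1.

Lemma lambdaE (R : realType) n k :
  lambda R n k = (nlambda (k o0 == k o1) (k o1 == k o2) (k o2 == k o3)
                    (k o0 == k o3 + (4 * n)%:Z))%:R.
Proof. by rewrite /lambda /nlambda; do ![case: ifP => _ //]. Qed.

(** Orbit-stabilizer in the quotient, checked by evaluating the boolean cases. *)
Lemma nlambda_nlinked a b c d : ~~ [&& a, b, c & d] ->
  (nlambda a b c d * nlinked a b c d)%N = 24%N.
Proof. by case: a; case: b; case: c; case: d; vm_compute. Qed.

(** The four relations together would give 4n = 0. *)
Lemma alcove_not_all n k : (0 < n)%N -> inLambda n k ->
  ~~ [&& k o0 == k o1, k o1 == k o2, k o2 == k o3 & k o0 == k o3 + (4 * n)%:Z].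
Proof. by move=> n0 /inLambdaP[_ [? ? ? ?]]; lia. Qed.

Lemma stab_eqm n k : (0 < n)%N -> inLambda n k ->
  stab (eqm n) k = nlinked (k o0 == k o1) (k o1 == k o2) (k o2 == k o3)
    (k o0 == k o3 + (4 * n)%:Z).
Proof.
move=> n0 Hk; apply: stab_linked => s; rewrite /eqm; apply: eq_forallb => i.
by rewrite ffunE linked_eqm.
Qed.

Lemma lambda_stab (R : realType) n k : (0 < n)%N -> inLambda n k ->
  lambda R n k * (stab (eqm n) k)%:R = 24%:R.
Proof.
move=> n0 Hk; rewrite stab_eqm // lambdaE.
move: (nlambda_nlinked _ _ _ _ (alcove_not_all n k n0 Hk)).
set a := nlambda _ _ _ _; set b := nlinked _ _ _ _; clearbody a b => e.
by rewrite -natrM e.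
Qed.

(* The inverse of [c_k] for [k] in the alcove: under (d), p = 1 + a + ab and q = 1 + c + bc. *)
Definition nties (a b c d : bool) : nat :=
  if d then 'C((1 + (a + (a && b)) + (1 + (c + (b && c))))%N, (1 + (a + (a && b)))%N) else 1%N.

(** Under (d) the p maximal and q minimal coordinates merge into one class modulo 4n, so the
    stabilizer grows from p! q! to (p+q)! on them; the ratio is the binomial coefficient in
    [c_k]. *)
Lemma nlambda_nties a b c d : ~~ [&& a, b, c & d] ->
  (nlambda a b c d * nlinked a b c false * nties a b c d)%N = 24%N.
Proof. by case: a; case: b; case: c; case: d; vm_compute. Qed.

Lemma kmax_inLambda n k : inLambda n k -> kmax k = k o0 /\ kmin k = k o3.
Proof. by case/inLambdaP => _ [? ? ? ?]; rewrite /kmax /kmin; lia. Qed.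


Lemma cnE (R : realType) n k : (0 < n)%N -> inLambda n k ->
  cn R n k = (nties (k o0 == k o1) (k o1 == k o2) (k o2 == k o3)
                    (k o0 == k o3 + (4 * n)%:Z))%:R^-1.
Proof.
move=> n0 Hk; have [kM km] := kmax_inLambda n k Hk.
case/inLambdaP: Hk => _ [H1 H2 H3 H4].
rewrite /cn /nties kM km.
have -> : (k o0 - k o3 < (4 * n)%:Z) = ~~ (k o0 == k o3 + (4 * n)%:Z) by lia.
case: eqP => [d|_]; last by rewrite invr1.
have card4 (P : pred 'I_4) : #|P| = (P o0 + P o1 + P o2 + P o3)%N.
  rewrite -sum1_card big_mkcond sum_ord4 /= !unfold_in.
  by case: (P o0); case: (P o1); case: (P o2); case: (P o3).
rewrite !card4 /= !eqxx.
have -> : (k o1 == k o0) = (k o0 == k o1) by lia.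
have -> : (k o2 == k o0) = (k o0 == k o1) && (k o1 == k o2) by lia.
have -> : (k o3 == k o0) = false by lia.
have -> : (k o0 == k o3) = false by lia.
have -> : (k o1 == k o3) = (k o1 == k o2) && (k o2 == k o3) by lia.
by case: (k o0 == k o1); case: (k o1 == k o2); case: (k o2 == k o3).
Qed.

(** Says that [lambda_k] is [c_k] times the size of the orbit of [k] as an integer vector, with the
    orbit size written as 24 over the stabilizer order. *)
Lemma cn_stab (R : realType) n k : (0 < n)%N -> inLambda n k ->
  cn R n k * 24%:R = lambda R n k * (stab eq_op k)%:R.
Proof.
move=> n0 Hk; have HL := linked_eq n k Hk.
have Ht := nlambda_nties _ _ _ _ (alcove_not_all n k n0 Hk).
rewrite (stab_linked eq_op k (k o0 == k o1) (k o1 == k o2) (k o2 == k o3) false).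
  rewrite lambdaE (cnE R n k n0 Hk); move: Ht.
  set a := nlambda _ _ _ _; set b := nlinked _ _ _ _; set c := nties _ _ _ _.
  clearbody a b c => Ht; rewrite -natrM -[in LHS]Ht mulrC (natrM _ (a * b)) mulfK // pnatr_eq0.
  by apply/eqP => h; rewrite h muln0 in Ht.
move=> s; apply/eqP/forallP => [/ffunP H i|H].
  by rewrite -HL {1}H ffunE.
by apply/ffunP => i; apply/eqP; rewrite ffunE HL.
Qed.

(** * Folding sums onto the alcove *)

Lemma sum_nat_delta (V : nzSemiRingType) (T : eqType) (X : seq T) (P : pred T) x0 :
  uniq X -> x0 \in X -> P x0 -> {in X, forall x, P x -> x = x0} ->
  \sum_(x <- X) (P x)%:R = 1 :> V.
Proof.
move=> uX x0X Px0 HP; rewrite (bigD1_seq x0) //= Px0 big_seq_cond big1 ?addr0 //.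
by move=> x /andP[xX /negP nx]; case: (P x) (HP x xX) => // H; case: nx; rewrite H.
Qed.

(* Both sides count, with weight [G x / #{(s, k)}], the triples (x, s, k) such that [k] is equivalent to [x] permuted by [s]. *)
Lemma fold_sum (C : numFieldType) (e : rel ivec) (X L : seq ivec) (G : ivec -> C) :
  reflexive e -> symmetric e -> transitive e ->
  (forall x y s, e (permv x s) (permv y s) = e x y) ->
  uniq X -> uniq L ->
  (forall x, x \in X -> exists s, exists2 k, k \in L & e k (permv x s)) ->
  (forall k k' s, k \in L -> k' \in L -> e k' (permv k s) -> k' = k) ->
  (forall k s, k \in L -> exists2 x, x \in X & e x (permv k s)) ->
  (forall x x', x \in X -> x' \in X -> e x x' -> x = x') ->
  (forall x k s, x \in X -> k \in L -> e k (permv x s) -> G x = G k) ->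
  \sum_(x <- X) G x = \sum_(k <- L) 24%:R / (stab e k)%:R * G k.
Proof.
move=> er es et ep uX uL HXL HL HLX HX HG.
have stab_neq0 k : (stab e k)%:R != 0 :> C.
  rewrite pnatr_eq0 -lt0n; apply/card_gt0P; exists 1%g.
  by rewrite inE permv1 er.
have e_inv x k s : e k (permv x s) = e x (permv k (s^-1)%g).
  by rewrite -(ep _ _ (s^-1)%g) permvM mulVg permv1 es.
(* For fixed [x] only [k0] can occur, and the admissible [s] form the coset of the stabilizer of
   [k0] through [s0]. *)
have fiber x k0 s0 : x \in X -> k0 \in L -> e k0 (permv x s0) ->
    \sum_(s : 'S_4) \sum_(k <- L) (e k (permv x s))%:R = (stab e k0)%:R :> C.
  move=> xX k0L e0.
  transitivity (\sum_(s : 'S_4) (e k0 (permv x s))%:R : C).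
    apply: eq_bigr => s _; case E: (e k0 (permv x s)).
      apply: (sum_nat_delta _ _ _ _ k0) => // k kL ek.
      apply: (HL k0 k 1%g) => //; rewrite permv1; apply: et ek _.
      by rewrite es.
    rewrite big_seq big1 // => k kL; case E': (e k _) => //.
    suff ek : e k (permv k0 (s * s0^-1)%g) by rewrite (HL k0 k _ k0L kL ek) E in E'.
    apply: et E' _; rewrite es (_ : permv x s = permv (permv x s0) (s * s0^-1)%g) ?ep //.
    by rewrite permvM mulgKV.
  rewrite (reindex_inj (mulIg s0)) /stab -sum1_card natr_sum big_mkcond /=.
  rewrite [RHS]big_mkcond /=; apply: eq_bigr => s _; rewrite inE.
  have -> : e k0 (permv k0 s) = e k0 (permv x (s * s0)%g).
    rewrite -permvM; move: e0; rewrite -(ep k0 _ s) => e0.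
    by apply/idP/idP => h; apply: et h _ => //; rewrite es.
  by case: (e _ _).
transitivity (\sum_(x <- X) \sum_(s : 'S_4) \sum_(k <- L)
    (e k (permv x s))%:R * (G k / (stab e k)%:R)).
  rewrite big_seq [RHS]big_seq; apply: eq_bigr => x xX.
  have [s0 [k0 k0L e0]] := HXL x xX.
  transitivity (\sum_(s : 'S_4) \sum_(k <- L)
      (e k (permv x s))%:R * (G x / (stab e k0)%:R)); last first.
    apply: eq_bigr => s _; rewrite big_seq [RHS]big_seq; apply: eq_bigr => k kL.
    case E: (e k _); rewrite ?mul0r // (HG _ _ _ xX kL E).
    (* Both stabilizer orders are values of the same double sum in [fiber]. *)
    congr (_ * (_ / _)); rewrite -(fiber _ _ _ xX kL E); exact/esym/(fiber _ _ _ xX k0L e0).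
  under eq_bigr => s _ do rewrite -mulr_suml.
  by rewrite -mulr_suml (fiber _ _ _ xX k0L e0) mulrC divfK.
rewrite exchange_big /=; under eq_bigr => s _ do rewrite exchange_big /=.
rewrite exchange_big /= big_seq [RHS]big_seq; apply: eq_bigr => k kL.
(* For fixed [k] and [s] exactly one [x] in [X] is admissible, so each of the 24 permutations
   contributes once. *)
transitivity (\sum_(s : 'S_4) (G k / (stab e k)%:R)).
  apply: eq_bigr => s _; rewrite -mulr_suml.
  have [x0 x0X ex0] := HLX k (s^-1)%g kL.
  have ek0 : e k (permv x0 s) by rewrite e_inv.
  suff -> : \sum_(x <- X) (e k (permv x s))%:R = 1 :> C by rewrite mul1r.
  apply: (sum_nat_delta C _ X (fun x => e k (permv x s)) x0 uX x0X ek0) => x xX /=.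
  by rewrite e_inv => ex; apply: HX => //; apply: et ex _; rewrite es.
have c24 : #|{: 'S_4}| = 24%N by rewrite card_Sn.
by rewrite sumr_const c24 -[LHS]mulr_natl mulrA mulrAC.
Qed.

(** * Duplicate-free lists for the index sets, and the two foldings *)

Definition box_seq (n : nat) (P : pred ivec) : seq ivec :=
  [seq ofbox u | u <- enum (box n) & P (ofbox u)].

Lemma big_box_seq (V : nmodType) n (P : pred ivec) (F : ivec -> V) :
  \sum_(u : box n | P (ofbox u)) F (ofbox u) = \sum_(k <- box_seq n P) F k.
Proof. by rewrite big_map big_filter big_enum_cond; apply: eq_bigl => u. Qed.

Lemma ofbox_inj n : injective (@ofbox n).
Proof.
move=> u v /ffunP H; apply/ffunP => i; apply: val_inj.
by move: (H i); rewrite !ffunE /=; lia.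
Qed.

Lemma box_seq_uniq n P : uniq (box_seq n P).
Proof. by rewrite (map_inj_uniq (ofbox_inj n)) filter_uniq ?enum_uniq. Qed.

(** The box loses nothing: as the coordinates sum to zero, 4 [k i] is the sum of its differences
    with the other three, so [k i] is at most 3n in absolute value. *)
Lemma mem_box_seq n (P : pred ivec) (k : ivec) : subpred P (inHstar n) ->
  (k \in box_seq n P) = P k.
Proof.
move=> HP; apply/mapP/idP => [[u]|Pk]; first by rewrite mem_filter => /andP[? _] ->.
case/inHstarP: (HP k Pk) => /inHP[Hs _] Hd.
have Hk i : 0 <= k i + (4 * n)%:Z <= (8 * n)%:Z.
  have aux (a b c d : int) : a + b + c + d = 0 ->
      a - b <= (4 * n)%:Z -> a - c <= (4 * n)%:Z -> a - d <= (4 * n)%:Z ->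
      b - a <= (4 * n)%:Z -> c - a <= (4 * n)%:Z -> d - a <= (4 * n)%:Z ->
      0 <= a + (4 * n)%:Z <= (8 * n)%:Z by lia.
  move: i; apply: ord4P.
  - by apply: (aux _ (k o1) (k o2) (k o3)).
  - by apply: (aux _ (k o0) (k o2) (k o3)) => //; rewrite -Hs; ring.
  - by apply: (aux _ (k o0) (k o1) (k o3)) => //; rewrite -Hs; ring.
  - by apply: (aux _ (k o0) (k o1) (k o2)) => //; rewrite -Hs; ring.
have Hk' i : (absz (k i + (4 * n)%:Z)%R < 8 * n + 1)%N by move: (Hk i); lia.
suff E : ofbox [ffun i => Ordinal (Hk' i)] = k.
  by exists [ffun i => Ordinal (Hk' i)]; rewrite ?E // mem_filter E Pk mem_enum.
by apply/ffunP => i; rewrite !ffunE /=; move: (Hk i); lia.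
Qed.

Lemma mem_Lambda_seq n k : (k \in box_seq n (inLambda n)) = inLambda n k.
Proof. by apply: mem_box_seq => x; exact: inLambda_Hstar. Qed.

Lemma mem_Hstar_seq n k : (k \in box_seq n (inHstar n)) = inHstar n k.
Proof. exact: mem_box_seq. Qed.

(* A transversal of H / 4n Z^4_H: the last three coordinates are reduced mod 4n and the first makes the sum vanish. *)
Definition coset_rep (n : nat) (u : 'I_4 * 'I_n * 'I_n * 'I_n) : ivec :=
  let: (r, a, b, c) := u in
  let x := (r + 4 * a)%N%:Z in let y := (r + 4 * b)%N%:Z in let z := (r + 4 * c)%N%:Z in
  mk4 (- (x + y + z)) x y z.

Definition reps (n : nat) : seq ivec :=
  [seq coset_rep n u | u <- enum {: 'I_4 * 'I_n * 'I_n * 'I_n}].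

Lemma coset_rep_inj n u v : eqm n (coset_rep n u) (coset_rep n v) -> u = v.
Proof.
case: u v => [[[r a] b] c] [[[r' a'] b'] c'] /eqmP[w Hw].
move: (Hw o1) (Hw o2) (Hw o3); rewrite !ffunE /= => H1 H2 H3.
have := ltn_ord r; have := ltn_ord a; have := ltn_ord b; have := ltn_ord c.
have := ltn_ord r'; have := ltn_ord a'; have := ltn_ord b'; have := ltn_ord c'.
move=> h1 h2 h3 h4 h5 h6 h7 h8.
have er : val r = val r' by rewrite /=; lia.
have n0 : (0 < n)%N by lia.
have aux (i j : 'I_n) t : (r + 4 * i)%N%:Z = (r' + 4 * j)%N%:Z + (4 * n)%N%:Z * t -> i = j.
  move=> H; apply: val_inj => /=; move: (ltn_ord i) (ltn_ord j) => hi hj.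
  rewrite /= in er; have ? : t = 0 by nia.
  by subst t; lia.
by rewrite (aux _ _ _ H1) (aux _ _ _ H2) (aux _ _ _ H3) (val_inj er).
Qed.

Lemma reps_uniq n : uniq (reps n).
Proof.
rewrite map_inj_uniq ?enum_uniq // => u v H; apply: (coset_rep_inj n).
by rewrite H eqm_refl.
Qed.

Lemma reps_inH n x : x \in reps n -> inH x.
Proof.
case/mapP => -[[[r a] b] c] _ ->; apply/inHP.
by rewrite !ffunE /=; split; [lia | split; lia].
Qed.

Lemma reps_eqm n x y : x \in reps n -> y \in reps n -> eqm n x y -> x = y.
Proof. by case/mapP => u _ -> /mapP[v _ ->] /coset_rep_inj ->. Qed.

Lemma reps_exists n x : (0 < n)%N -> inH x -> exists2 y, y \in reps n & eqm n y x.
Proof.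
move=> n0 /inHP[Hs [H1 H2 H3]].
(* Mixed-radix digits: the common residue modulo 4, then the quotient by 4 reduced modulo n. *)
pose r := absz (x o0 %% 4)%Z; have r4 : (r < 4)%N by rewrite /r; lia.
pose q (i : 'I_4) := ((x i - r%:Z) %/ 4)%Z.
have q_mod_ge0 i : 0 <= (q i %% n%:Z)%Z by rewrite modz_ge0 //; lia.
have q_mod_lt i : (q i %% n%:Z)%Z < n%:Z by rewrite ltz_pmod.
have Hm i : (absz (q i %% n%:Z)%Z < n)%N by move: (q_mod_ge0 i) (q_mod_lt i); lia.
have K i : (4 %| x i - x o0)%Z ->
    exists w, (r + 4 * absz (q i %% n%:Z)%Z)%N%:Z = x i + (4 * n)%:Z * w.
  move=> Hi; exists (- (q i %/ n%:Z)%Z).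
  have E : x i - r%:Z = q i * 4 by rewrite /q /r; lia.
  move: (divz_eq (q i) n%:Z) (q_mod_ge0 i).
  by move: (q i %% n)%Z (q i %/ n)%Z (q i) E => ? ? ?; nia.
have [w1 W1] := K o1 H1; have [w2 W2] := K o2 H2; have [w3 W3] := K o3 H3.
exists (coset_rep n (Ordinal r4, Ordinal (Hm o1), Ordinal (Hm o2), Ordinal (Hm o3))).
  by apply: map_f; rewrite mem_enum.
apply/eqmP; exists (mk4 (- (w1 + w2 + w3)) w1 w2 w3).
by apply: ord4P; rewrite !ffunE /= ?W1 ?W2 ?W3; nia.
Qed.

Lemma sum_reps (V : nmodType) n (F : ivec -> V) :
  \sum_(x <- reps n) F x =
  \sum_(r < 4) \sum_(a < n) \sum_(b < n) \sum_(c < n) F (coset_rep n (r, a, b, c)).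
Proof. by rewrite big_map big_enum !pair_bigA; apply: eq_bigr => -[[[? ?] ?] ?]. Qed.

(** Folding for congruence modulo 4n; by [lambda_stab] the weights that appear are the
    [lambda_k]. *)
Lemma sum_reps_alcove (C : numFieldType) n (G : ivec -> C) : (0 < n)%N ->
  (forall x s, G (permv x s) = G x) ->
  (forall x y, inH x -> inH y -> eqm n x y -> G x = G y) ->
  \sum_(x <- reps n) G x =
  \sum_(k <- box_seq n (inLambda n)) 24%:R / (stab (eqm n) k)%:R * G k.
Proof.
move=> n0 Gp Ge; apply: fold_sum.
- exact: eqm_refl.
- exact: eqm_sym.
- exact: eqm_trans.
- by move=> x y s; apply: eqm_permv.
- exact: reps_uniq.
- exact: box_seq_uniq.
- move=> x /reps_inH Hx; have [s [k Hk ek]] := alcove_exists n x n0 Hx.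
  by exists s, k => //; rewrite mem_Lambda_seq.
- by move=> k k' s; rewrite !mem_Lambda_seq => ? ?; apply: alcove_uniq.
- move=> k s; rewrite mem_Lambda_seq => /inLambdaP[Hk _].
  by apply: reps_exists; rewrite ?inH_permv.
- exact: reps_eqm.
- move=> x k s /reps_inH Hx; rewrite mem_Lambda_seq => /inLambdaP[Hk _] ek.
  by rewrite -(Gp x s); apply/esym/Ge; rewrite ?inH_permv.
Qed.

Lemma kmax_le (k : ivec) m : kmax k <= m <-> forall i, k i <= m.
Proof.
rewrite /kmax !ge_max; split=> [/andP[/andP[? ?] /andP[? ?]]|H]; last by rewrite !H.
exact: ord4P.
Qed.

Lemma kmin_ge (k : ivec) m : m <= kmin k <-> forall i, m <= k i.
Proof.
rewrite /kmin !le_min; split=> [/andP[/andP[? ?] /andP[? ?]]|H]; last by rewrite !H.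
exact: ord4P.
Qed.

Lemma kmax_permv k s : kmax (permv k s) = kmax k.
Proof.
suff le k' t : kmax (permv k' t) <= kmax k'.
  by apply/eqP; rewrite eq_le le -{1}[k]permv1 -(mulVg s) -permvM le.
by apply/kmax_le => i; rewrite ffunE; apply: (kmax_le k' (kmax k')).1.
Qed.

Lemma kmin_permv k s : kmin (permv k s) = kmin k.
Proof.
suff ge k' t : kmin k' <= kmin (permv k' t).
  by apply/eqP; rewrite eq_le ge -{2}[k]permv1 -(mulVg s) -permvM ge.
by apply/kmin_ge => i; rewrite ffunE; apply: (kmin_ge k' (kmin k')).1.
Qed.

Lemma cn_permv (R : realType) n k s : cn R n (permv k s) = cn R n k.
Proof.
rewrite /cn kmax_permv kmin_permv.
have card_level m : #|[pred i | permv k s i == m]| = #|[pred i | k i == m]|.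
  rewrite -!sum1_card [RHS](reindex_inj (@perm_inj _ s)).
  by apply: eq_bigl => i; rewrite !inE ffunE.
by rewrite !card_level.
Qed.

(** Folding for plain equality: each orbit in the symmetric index set meets the alcove in its sorted
    member, and [cn_stab] converts the weights. *)
Lemma sum_Hstar_alcove (R : realType) n (F : ivec -> R[i]) : (0 < n)%N ->
  (forall x s, F (permv x s) = F x) ->
  \sum_(x <- box_seq n (inHstar n)) cn R n x * F x =
  \sum_(k <- box_seq n (inLambda n)) lambda R n k * F k.
Proof.
move=> n0 Fp; pose G x := cn R n x * F x.
have permv_inj x y s : (permv x s == permv y s) = (x == y).
  apply/eqP/eqP => [H|-> //].
  by rewrite -[x]permv1 -[y]permv1 -(mulVg s) -!permvM H.
rewrite (fold_sum _ eq_op _ (box_seq n (inLambda n)) G).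
- rewrite big_seq [RHS]big_seq; apply: eq_bigr => k; rewrite mem_Lambda_seq => Hk.
  have S0 : (stab eq_op k)%:R != 0 :> R[i].
    by rewrite pnatr_eq0 -lt0n; apply/card_gt0P; exists 1%g; rewrite inE permv1 /=.
  rewrite /G mulrA; congr (_ * _).
  by rewrite mulrAC [24%:R * _]mulrC (cn_stab R n k n0 Hk) mulfK.
- exact: eqxx.
- exact: eq_sym.
- by move=> y x z /eqP -> /eqP ->.
- exact: permv_inj.
- exact: box_seq_uniq.
- exact: box_seq_uniq.
- move=> x; rewrite mem_Hstar_seq => Hx; have [s [S1 S2 S3]] := sort4 x.
  exists s, (permv x s) => //; rewrite mem_Lambda_seq; apply/inLambdaP.
  have /inHstarP[HH Hd] : inHstar n (permv x s) by rewrite inHstar_permv.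
  by split=> //; split=> //; move: (Hd o0 o3); lia.
- move=> k k' s; rewrite !mem_Lambda_seq => Hk Hk' /eqP e.
  by apply: (alcove_uniq n k k' s n0 Hk Hk'); rewrite e eqm_refl.
- move=> k s; rewrite mem_Lambda_seq => Hk; exists (permv k s) => //.
  by rewrite mem_Hstar_seq inHstar_permv inLambda_Hstar.
- by move=> x x' _ _ /eqP.
- by move=> x k s _ _ /eqP ->; rewrite /G cn_permv Fp.
Qed.

(** * Characters of the finite quotient *)

Lemma cexpiD (R : realType) (x y : R) : cexpi (x + y) = cexpi x * cexpi y.
Proof.
by rewrite /cexpi cosD sinD; apply/eqP; rewrite eq_complex /= eqxx addrC eqxx.
Qed.

Lemma conj_cexpi (R : realType) (x : R) : (cexpi x)^* = cexpi (- x).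
Proof. by rewrite /cexpi cosN sinN. Qed.

Lemma cexpi0 (R : realType) : cexpi (0 : R) = 1.
Proof. by rewrite /cexpi cos0 sin0. Qed.

Lemma cexpi_2pi (R : realType) : cexpi (pi *+ 2 : R) = 1.
Proof. by rewrite /cexpi cos2pi sin_mulr2n sinpi mulr0 mul0rn. Qed.

(** If cos x = 1, the half-angle formula gives sin(x/2) = 0, whereas the sine is positive strictly
    between 0 and pi. *)
Lemma cexpi_eq1 (R : realType) (x : R) : 0 < x < pi *+ 2 -> cexpi x != 1.
Proof.
move=> /andP[x0 x2]; apply/negP => /eqP[c1 _].
have s0 : 0 < sin (x / 2) by apply: sin_gt0_pi; rewrite mulr2n in x2; apply/andP; split; lra.
have : sin (x / 2) ^+ 2 = 0.
  rewrite sin2cos2.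
  have x2E : x / 2 *+ 2 = x by rewrite mulr2n; lra.
  by have := cos_mulr2n (x / 2); rewrite x2E c1 mulr2n; lra.
by move/eqP; rewrite expf_eq0 /= => /eqP h; rewrite h ltxx in s0.
Qed.

(** The [m]-th power of the primitive 16n-th root of unity; the order 16n comes from the phase pi/2
    times [k.j] / 4n. *)
Definition zeta (R : realType) (n : nat) (m : int) : R[i] :=
  cexpi (pi / (8 * n)%:R * m%:~R).

Section Root.
Variables (R : realType) (n : nat).
Hypothesis n0 : (0 < n)%N.

Let nR0 : n%:R != 0 :> R.
Proof. by rewrite pnatr_eq0 -lt0n. Qed.

Lemma zetaD a b : zeta R n (a + b) = zeta R n a * zeta R n b.
Proof. by rewrite /zeta intrD mulrDr cexpiD. Qed.

Lemma zeta0 : zeta R n 0 = 1.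
Proof. by rewrite /zeta mulr0 cexpi0. Qed.

Lemma conj_zeta a : (zeta R n a)^* = zeta R n (- a).
Proof. by rewrite /zeta conj_cexpi -mulrN -intrN. Qed.

Lemma zetaMn a k : zeta R n (a * k%:Z) = zeta R n a ^+ k.
Proof.
elim: k => [|k IH]; first by rewrite mulr0 zeta0.
by rewrite intS mulrDr mulr1 zetaD IH exprS.
Qed.

Lemma zeta_period q : zeta R n ((16 * n)%:Z * q) = 1.
Proof.
have r1 : zeta R n (16 * n)%:Z = 1.
  rewrite /zeta -[RHS](cexpi_2pi R); congr cexpi.
  by rewrite -pmulrn !natrM mulr2n; field.
case: q => k; first by rewrite zetaMn r1 expr1n.
by rewrite NegzE mulrN -conj_zeta zetaMn r1 expr1n rmorph1.
Qed.

(** Removing multiples of 16n leaves an angle in [0, 2 pi), where the exponential is 1 only at 0. *)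
Lemma zeta_eq1 a : (zeta R n a == 1) = ((16 * n)%:Z %| a)%Z.
Proof.
have N0 : (0 : int) < (16 * n)%:Z by lia.
apply/idP/dvdzP => [|[q ->]]; last by rewrite mulrC zeta_period.
rewrite {1}(divz_eq a (16 * n)%:Z) zetaD [_ * (16 * n)%:Z]mulrC zeta_period mul1r => r1.
exists (a %/ (16 * n)%:Z)%Z; rewrite {1}(divz_eq a (16 * n)%:Z).
suff -> : (a %% (16 * n)%:Z)%Z = 0 by rewrite addr0.
apply/eqP; move: r1; apply: contraTT => m0.
have m_gt0 : 0 < (a %% (16 * n)%:Z)%Z by rewrite lt_neqAle eq_sym m0 modz_ge0 //; lia.
have m_lt : (a %% (16 * n)%:Z)%Z < (16 * n)%:Z by rewrite ltz_pmod.
have p0 : 0 < pi / (8 * n)%:R :> R by rewrite divr_gt0 ?pi_gt0 // ltr0n; lia.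
apply: cexpi_eq1; apply/andP; split; first by rewrite mulr_gt0 // ltr0z.
have -> : pi *+ 2 = pi / (8 * n)%:R * (16 * n)%:Z%:~R :> R.
  by rewrite -pmulrn !natrM mulr2n; field.
by rewrite ltr_pM2l // ltr_int.
Qed.

(** A geometric sum whose ratio is an N-th root of unity. *)
Lemma sum_zeta a N : ((16 * n)%:Z %| a * N%:Z)%Z ->
  \sum_(r < N) zeta R n (a * r%:Z) = if ((16 * n)%:Z %| a)%Z then N%:R else 0.
Proof.
move=> aN; under eq_bigr => r _ do rewrite zetaMn.
rewrite -zeta_eq1; case: eqP => [->|/eqP r1].
  under eq_bigr => r _ do rewrite expr1n.
  by rewrite sumr_const card_ord.
have := subrX1 (zeta R n a) N; rewrite -zetaMn.
have /eqP -> : zeta R n (a * N%:Z) == 1 by rewrite zeta_eq1.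
by rewrite subrr => /esym/eqP; rewrite mulf_eq0 subr_eq0 (negPf r1) => /eqP.
Qed.

Definition dot (k j : ivec) : int := \sum_(i < 4) k i * j i.

Lemma phi_node k j : phi k (node R n j) = zeta R n (dot k j).
Proof.
rewrite /phi /zeta /node /dot; congr cexpi.
rewrite raddf_sum !mulr_sumr; apply: eq_bigr => i _.
by rewrite /= intrM !natrM; field.
Qed.

(** Orthogonality of characters on the quotient: in the coordinates of [coset_rep] the sum factors
    into four geometric sums. *)
Lemma sum_reps_zeta d : inH d ->
  \sum_(x <- reps n) zeta R n (dot x d) =
  if eqm n d 0 then (4 * n ^ 3)%:R else 0.
Proof.
case/inHP => Hs [/dvdzP[e1 H1] /dvdzP[e2 H2] /dvdzP[e3 H3]].
pose e := e1 + e2 + e3.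
(* As [x] has zero sum, its product with [d] only involves the differences of [d i] with [d o0],
   which are 4 [e1], 4 [e2], 4 [e3]. *)
have E r a b c : zeta R n (dot (coset_rep n (r, a, b, c)) d) =
    zeta R n (4 * e * r%:Z) * (zeta R n (16 * e1 * a%:Z) *
      (zeta R n (16 * e2 * b%:Z) * zeta R n (16 * e3 * c%:Z))).
  rewrite -!zetaD /dot sum_ord4 !ffunE /=; congr zeta.
  have -> : d o1 = d o0 + e1 * 4 by rewrite -H1; ring.
  have -> : d o2 = d o0 + e2 * 4 by rewrite -H2; ring.
  have -> : d o3 = d o0 + e3 * 4 by rewrite -H3; ring.
  have PE (m : nat) : (r + 4 * m)%N%:Z = r%:Z + 4 * m%:Z by lia.
  by rewrite /e !PE; ring.
transitivity ((\sum_(r < 4) zeta R n (4 * e * r%:Z)) *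
    ((\sum_(a < n) zeta R n (16 * e1 * a%:Z)) *
    ((\sum_(b < n) zeta R n (16 * e2 * b%:Z)) *
     (\sum_(c < n) zeta R n (16 * e3 * c%:Z))))).
  rewrite sum_reps mulr_suml; apply: eq_bigr => r _.
  rewrite mulr_suml mulr_sumr; apply: eq_bigr => a _.
  rewrite mulr_suml !mulr_sumr; apply: eq_bigr => b _.
  by rewrite !mulr_sumr; apply: eq_bigr => c _; rewrite E.
have dvd16 f : ((16 * n)%:Z %| 16 * f)%Z = (n%:Z %| f)%Z.
  by rewrite PoszM dvdz_mul2l.
have S f : \sum_(a < n) zeta R n (16 * f * a%:Z) = if (n%:Z %| f)%Z then n%:R else 0.
  rewrite sum_zeta ?dvd16 //.
  by rewrite -mulrA dvd16 dvdz_mull.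
have Hd : eqm n d 0 =
    [&& (n%:Z %| e1)%Z, (n%:Z %| e2)%Z, (n%:Z %| e3)%Z & ((16 * n)%:Z %| 4 * e)%Z].
  apply/eqmP/and4P => [[w Hw]|[/dvdzP[f1 F1] /dvdzP[f2 F2] /dvdzP[f3 F3] /dvdzP[g G]]].
    move: (Hw o0) (Hw o1) (Hw o2) (Hw o3); rewrite !ffunE => W0 W1 W2 W3.
    have Ws : w o0 + w o1 + w o2 + w o3 = 0 by nia.
    split; apply/dvdzP.
    - by exists (w o1 - w o0); nia.
    - by exists (w o2 - w o0); nia.
    - by exists (w o3 - w o0); nia.
    - by exists (- w o0); rewrite /e; nia.
  (* The zero sum of [d] gives [d o0] = - [e] = - 4n [g], and [d i] exceeds it by 4n [f1], 4n [f2],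
     4n [f3]. *)
  exists (mk4 (- g) (f1 - g) (f2 - g) (f3 - g)).
  have G' : 4 * g = f1 + f2 + f3 by rewrite /e in G; nia.
  by apply: ord4P; rewrite !ffunE /=; nia.
rewrite !S Hd.
case: dvdzP => [[f1 F1]|_]; rewrite ?mul0r ?mulr0 //=.
case: dvdzP => [[f2 F2]|_]; rewrite ?mul0r ?mulr0 //=.
case: dvdzP => [[f3 F3]|_]; rewrite ?mul0r ?mulr0 //=.
(* The sum over [r] is evaluated last: its ratio is a fourth root of unity once n divides [e1], [e2]
   and [e3]. *)
rewrite sum_zeta; last first.
  apply/dvdzP; exists (f1 + f2 + f3); rewrite /e F1 F2 F3 PoszM; ring.
case: ifP => _; rewrite ?mul0r // natrM natrX; ring.
Qed.
End Root.

(** * Discrete orthogonality and interpolation *)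

Lemma dotC k j : dot k j = dot j k.
Proof. by apply: eq_bigr => i _; rewrite mulrC. Qed.

Lemma dot_permv k j s : dot (permv k s) (permv j s) = dot k j.
Proof.
rewrite /dot [RHS](reindex_inj (@perm_inj _ s)).
by apply: eq_bigr => i _; rewrite !ffunE.
Qed.

Lemma TC_node (R : realType) n k j : (0 < n)%N ->
  TC k (node R n j) = 24%:R^-1 * \sum_(s : 'S_4) zeta R n (dot k (permv j s)).
Proof.
move=> n0; rewrite /TC /Pplus; congr (_ * _); apply: eq_bigr => s _.
rewrite -phi_node //; congr cexpi; congr (_ * _).
by apply: eq_bigr => i _; rewrite /node ffunE.
Qed.

Lemma TC_permv (R : realType) k s (t : rvec R) : TC (permv k s) t = TC k t.
Proof.
rewrite /TC /Pplus; congr (_ * _).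
rewrite [RHS](reindex_inj (mulgI (s^-1)%g)); apply: eq_bigr => u _.
rewrite /phi; congr cexpi; congr (_ * _).
rewrite [RHS](reindex_inj (@perm_inj _ s)); apply: eq_bigr => i _.
by rewrite ffunE permM permK.
Qed.

(** Moving a permutation across the dot product inverts it, and inversion is a bijection of
    ['S_4]. *)
Lemma TC_node_sym (R : realType) n k j : (0 < n)%N ->
  TC k (node R n j) = TC j (node R n k).
Proof.
move=> n0; rewrite !TC_node //; congr (_ * _).
rewrite [RHS](reindex_inj invg_inj); apply: eq_bigr => s _.
by rewrite -(dot_permv j _ s) permvM mulgV permv1 dotC.
Qed.

(** The translation 4n [v] has zero sum and the entries of [d] agree modulo 4, so the dot product
    changes by a multiple of 16n. *)
Lemma zeta_dot_eqm (R : realType) n x y d : (0 < n)%N -> inH x -> inH y -> inH d ->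
  eqm n x y -> zeta R n (dot x d) = zeta R n (dot y d).
Proof.
move=> n0 /inHP[Hx _] /inHP[Hy _] /inHP[_ [/dvdzP[e1 D1] /dvdzP[e2 D2] /dvdzP[e3 D3]]].
case/eqmP => v Hv.
have Hs : v o0 + v o1 + v o2 + v o3 = 0 by move: Hx; rewrite !Hv; nia.
have -> : dot x d = dot y d + (16 * n)%:Z * (v o1 * e1 + v o2 * e2 + v o3 * e3).
  rewrite /dot !sum_ord4 !Hv.
  have -> : d o1 = d o0 + e1 * 4 by rewrite -D1; ring.
  have -> : d o2 = d o0 + e2 * 4 by rewrite -D2; ring.
  have -> : d o3 = d o0 + e3 * 4 by rewrite -D3; ring.
  have -> : v o0 = - (v o1 + v o2 + v o3) by lia.
  by rewrite !PoszM; ring.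
by rewrite zetaD zeta_period // mulr1.
Qed.

Lemma TC_node_eqm (R : realType) n x y j : (0 < n)%N -> inH x -> inH y -> inH j ->
  eqm n x y -> TC x (node R n j) = TC y (node R n j).
Proof.
move=> n0 Hx Hy Hj e; rewrite !TC_node //; congr (_ * _); apply: eq_bigr => s _.
by apply: zeta_dot_eqm; rewrite ?inH_permv.
Qed.

Lemma inH_sub x y : inH x -> inH y -> inH (x - y).
Proof.
case/inHP => ? [? ? ?] /inHP[? [? ? ?]].
have subE i : (x - y) i = x i - y i by rewrite !ffunE.
by apply/inHP; rewrite !subE; split; [lia | split; lia].
Qed.

(** The weighted sum unfolds to the whole quotient, where the product of two averages becomes a
    double average of characters. A pair (t, s) survives when [j] permuted by [s] is congruent to
    [j'] permuted by [t]. *)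
Lemma TC_orthogonal (R : realType) n j j' : (0 < n)%N -> inLambda n j -> inLambda n j' ->
  lambda R n j' * \sum_(k <- box_seq n (inLambda n))
    lambda R n k * TC k (node R n j) * (TC k (node R n j'))^* =
  if j == j' then (4 * n ^ 3)%:R else 0.
Proof.
move=> n0 Lj Lj'.
have [Hj _] := inLambdaP _ _ Lj; have [Hj' _] := inLambdaP _ _ Lj'.
pose G (k : ivec) := TC k (node R n j) * (TC k (node R n j'))^*.
have -> : \sum_(k <- box_seq n (inLambda n))
    lambda R n k * TC k (node R n j) * (TC k (node R n j'))^* = \sum_(x <- reps n) G x.
  rewrite (sum_reps_alcove _ n G n0); last 2 first.
  - by move=> x s; rewrite /G !TC_permv.
  - by move=> x y Hx Hy e; rewrite /G !(TC_node_eqm R n x y) // .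
  rewrite big_seq [RHS]big_seq; apply: eq_bigr => k; rewrite mem_Lambda_seq => Lk.
  rewrite /G -mulrA -(lambda_stab R n k n0 Lk) mulfK //.
  rewrite pnatr_eq0 -lt0n; apply/card_gt0P; exists 1%g.
  by rewrite inE permv1 eqm_refl.
have GE x : G x = 24%:R^-1 ^+ 2 * \sum_(t : 'S_4) \sum_(s : 'S_4)
    zeta R n (dot x (permv j s - permv j' t)).
  rewrite /G !TC_node // rmorphM rmorph_sum fmorphV rmorph_nat mulrACA expr2.
  congr (_ * _); rewrite mulr_sumr; apply: eq_bigr => t _.
  rewrite mulr_suml; apply: eq_bigr => s _.
  rewrite /= conj_zeta -zetaD; congr zeta.
  by rewrite /dot !sum_ord4 !ffunE; ring.
under eq_bigr => x _ do rewrite GE.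
rewrite -mulr_sumr exchange_big /=.
under eq_bigr => t _ do rewrite exchange_big /=.
have Hd s t : \sum_(x <- reps n) zeta R n (dot x (permv j s - permv j' t)) =
    (eqm n j' (permv j (t^-1 * s)%g))%:R * (4 * n ^ 3)%:R.
  rewrite sum_reps_zeta ?inH_sub ?inH_permv //.
  have -> : eqm n (permv j s - permv j' t) 0 = eqm n (permv j s) (permv j' t).
    by apply: eq_forallb => i; rewrite !ffunE subr0.
  rewrite -(eqm_permv n j' _ t) permvM mulKVg eqm_sym.
  by case: (eqm _ _ _); rewrite ?mul1r ?mul0r.
(* After the shift by [t], the surviving [s] form the stabilizer of [j] if [j = j']; otherwise
   [alcove_uniq] excludes them all. *)
have Ht t : \sum_(s : 'S_4) \sum_(x <- reps n) zeta R n (dot x (permv j s - permv j' t)) =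
    (if j == j' then (stab (eqm n) j)%:R else 0) * (4 * n ^ 3)%:R.
  under eq_bigr => s _ do rewrite Hd.
  rewrite -mulr_suml (reindex_inj (mulgI t)) /=; congr (_ * _).
  under eq_bigr => s _ do rewrite mulKg.
  case: eqP => [<-|ne].
    rewrite /stab -sum1_card natr_sum [RHS]big_mkcond /=.
    by apply: eq_bigr => s _; rewrite inE; case: (eqm _ _ _).
  rewrite big1 // => s _; case E: (eqm _ _ _) => //.
  by case: ne; rewrite (alcove_uniq n j j' s n0 Lj Lj' E).
under eq_bigr => t _ do rewrite Ht.
have c24 : #|{: 'S_4}| = 24%N by rewrite card_Sn.
rewrite sumr_const c24 -[X in _ * (_ * X)]mulr_natl.
case: eqP => [<-|_]; last by rewrite !(mul0r, mulr0).
have := lambda_stab R n j n0 Lj; set l := lambda _ _ _; set m := (stab _ _)%:R => lm.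
have n24 : 24%:R != 0 :> R[i] by rewrite pnatr_eq0.
transitivity (l * m * (24%:R^-1 ^+ 2 * 24%:R) * (4 * n ^ 3)%:R); first by ring.
have -> : 24%:R^-1 ^+ 2 * 24%:R = 24%:R^-1 :> R[i] by rewrite expr2 divfK.
by rewrite lm mulfV // mul1r.
Qed.

Lemma ell_triE (R : realType) n j (t : rvec R) :
  ell_tri n j t = \sum_(k <- box_seq n (inLambda n))
    lambda R n j / (4 * n ^ 3)%:R * (lambda R n k * TC k t * (TC k (node R n j))^*).
Proof.
rewrite /ell_tri mulr_sumr (big_box_seq _ n (inLambda n)
  (fun k => lambda R n j / (4 * n ^ 3)%:R * (lambda R n k * TC k t * (TC k (node R n j))^*))).
by [].
Qed.

Lemma LstarE (R : realType) n f (t : rvec R) :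
  Lstar n f t = \sum_(j <- box_seq n (inLambda n)) f (node R n j) * ell_tri n j t.
Proof.
exact: (big_box_seq _ n (inLambda n) (fun j => f (node R n j) * ell_tri n j t)).
Qed.

Lemma inRH_node (R : realType) n j : inH j -> inRH (node R n j).
Proof.
case/andP => /eqP Hs _; rewrite /inRH /node -mulr_suml.
by rewrite -[\sum_(i < 4) _](rmorph_sum (intmul 1)) Hs mul0r.
Qed.

Lemma Lstar_inTCn (R : realType) n (f : rvec R -> R[i]) : inTCn n (Lstar n f).
Proof.
pose c (k : ivec) : R[i] := \sum_(j <- box_seq n (inLambda n)) f (node R n j) *
  (lambda R n j / (4 * n ^ 3)%:R * (lambda R n k * (TC k (node R n j))^*)).
exists c => t _; rewrite LstarE [RHS](big_box_seq _ n (inLambda n) (fun k => c k * TC k t)).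
under eq_bigr => j _ do rewrite ell_triE mulr_sumr.
rewrite exchange_big /=; apply: eq_bigr => k _.
by rewrite mulr_suml; apply: eq_bigr => j _; ring.
Qed.

Lemma ell_tri_node (R : realType) n j j' : (0 < n)%N -> inLambda n j -> inLambda n j' ->
  ell_tri n j (node R n j') = (j == j')%:R.
Proof.
move=> n0 Lj Lj'; rewrite ell_triE -mulr_sumr.
have M0 : (4 * n ^ 3)%:R != 0 :> R[i] by rewrite pnatr_eq0 muln_eq0 expn_eq0; lia.
by rewrite mulrAC TC_orthogonal // eq_sym; case: eqP; rewrite ?mul0r ?divff.
Qed.

Lemma Lstar_node (R : realType) n (f : rvec R -> R[i]) j : (0 < n)%N -> inLambda n j ->
  Lstar n f (node R n j) = f (node R n j).
Proof.
move=> n0 Lj; rewrite LstarE (bigD1_seq j) ?box_seq_uniq ?mem_Lambda_seq //=.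
rewrite ell_tri_node // eqxx mulr1 big_seq_cond big1 ?addr0 // => k.
by rewrite mem_Lambda_seq => /andP[Lk nk]; rewrite ell_tri_node // (negPf nk) mulr0.
Qed.

(* [TC_k(j/4n) = TC_j(k/4n)] turns the orthogonality over frequencies into an orthogonality over nodes, so the coefficients of [g] are recovered from its nodal values. *)
Lemma TCn_reconstruct (R : realType) n (g : rvec R -> R[i]) t : (0 < n)%N -> inTCn n g -> inRH t ->
  g t = \sum_(j <- box_seq n (inLambda n)) g (node R n j) * ell_tri n j t.
Proof.
move=> n0 [c Hc] Ht.
have Hg s : inRH s -> g s = \sum_(k <- box_seq n (inLambda n)) c k * TC k s.
  by move=> /Hc ->; exact: (big_box_seq _ n (inLambda n) (fun k => c k * TC k s)).
pose M : R[i] := (4 * n ^ 3)%:R.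
have M0 : M != 0 by rewrite pnatr_eq0 muln_eq0 expn_eq0; lia.
(* Orthogonality is inserted so that the sum over [k'] collapses to [c k * M]. *)
transitivity (\sum_(k <- box_seq n (inLambda n)) TC k t / M *
  \sum_(k' <- box_seq n (inLambda n)) c k' * (lambda R n k *
    \sum_(j <- box_seq n (inLambda n))
      lambda R n j * TC j (node R n k') * (TC j (node R n k))^*)).
  rewrite Hg // big_seq [RHS]big_seq; apply: eq_bigr => k; rewrite mem_Lambda_seq => Lk.
  rewrite (bigD1_seq k) ?box_seq_uniq ?mem_Lambda_seq //= TC_orthogonal // eqxx.
  rewrite big_seq_cond big1 => [|k']; first by rewrite addr0 -/M [RHS]mulrCA divfK.
  rewrite mem_Lambda_seq => /andP[Lk' nk'].
  by rewrite TC_orthogonal // (negPf nk') mulr0.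
under eq_bigr => k _ do rewrite mulr_sumr.
transitivity (\sum_(k <- box_seq n (inLambda n)) \sum_(k' <- box_seq n (inLambda n))
    \sum_(j <- box_seq n (inLambda n)) TC k t / M * (c k' * (lambda R n k *
      (lambda R n j * TC j (node R n k') * (TC j (node R n k))^*)))).
  by apply: eq_bigr => k _; apply: eq_bigr => k' _; rewrite !mulr_sumr.
under eq_bigr => k _ do rewrite exchange_big /=.
rewrite exchange_big /= big_seq [RHS]big_seq; apply: eq_bigr => j; rewrite mem_Lambda_seq.
case/inLambdaP => Hj _; rewrite (Hg _ (inRH_node R n j Hj)) ell_triE mulr_sumr.
apply: eq_bigr => k _; rewrite mulr_suml; apply: eq_bigr => k' _.
by rewrite !(TC_node_sym R n j) // -/M; ring.
Qed.

(** * The compact formula for the fundamental polynomials *)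

Lemma phi_sub (R : realType) k (t s : rvec R) : phi k (vsub t s) = phi k t * (phi k s)^*.
Proof.
rewrite /phi conj_cexpi -cexpiD; congr cexpi; rewrite -mulrN -mulrDr; congr (_ * _).
by rewrite -sumrB; apply: eq_bigr => i _; rewrite mulrBr.
Qed.

(** The kernel separates the variable from the node, and symmetrization acts on the variable only;
    the node factor is still a plain exponential. *)
Lemma Pplus_ell (R : realType) n j (t : rvec R) : (0 < n)%N ->
  Pplus (ell n j) t = ((4 * n ^ 3)%:R)^-1 *
    \sum_(k <- box_seq n (inHstar n)) cn R n k * (TC k t * (phi k (node R n j))^*).
Proof.
move=> n0; rewrite /Pplus mulr_sumr.
transitivity (\sum_(s : 'S_4) ((4 * n ^ 3)%:R)^-1 * \sum_(k <- box_seq n (inHstar n))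
    (24%:R^-1 * (cn R n k * (phi k (fun i => t (s i)) * (phi k (node R n j))^*)))).
  apply: eq_bigr => s _; rewrite /ell /Phistar.
  rewrite (big_box_seq _ n (inHstar n) (fun k => cn R n k * phi k _)).
  rewrite [LHS]mulrCA [X in _ * X = _]mulr_sumr; congr (_ * _); apply: eq_bigr => k _.
  by rewrite phi_sub.
rewrite -mulr_sumr; congr (_ * _); rewrite exchange_big /=; apply: eq_bigr => k _.
rewrite /TC /Pplus -mulr_sumr -mulr_sumr -mulr_suml; ring.
Qed.

(* [c_k] and [TC_k] are invariant under permutations of [k], so the conjugated exponential may be averaged to [TC_k]. *)
Lemma sum_Hstar_average (R : realType) n j (t : rvec R) : (0 < n)%N ->
  \sum_(k <- box_seq n (inHstar n)) cn R n k * (TC k t * (phi k (node R n j))^*) =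
  \sum_(k <- box_seq n (inHstar n)) cn R n k * (TC k t * (TC k (node R n j))^*).
Proof.
move=> n0; pose L := box_seq n (inHstar n).
have perm_L s : perm_eq [seq permv k s | k <- L] L.
  have inj : injective (permv^~ s).
    by move=> x y H; rewrite -[x]permv1 -[y]permv1 -(mulVg s) -!permvM H.
  apply: uniq_perm => [||x]; first by rewrite (map_inj_uniq inj) box_seq_uniq.
    exact: box_seq_uniq.
  rewrite mem_Hstar_seq; apply/mapP/idP => [[k]|Hx].
    by rewrite mem_Hstar_seq => Hk ->; rewrite inHstar_permv.
  exists (permv x (s^-1)%g); first by rewrite mem_Hstar_seq inHstar_permv.
  by rewrite permvM mulgV permv1.
(* Reindexing the frequencies by the inverse permutation transfers [s] to the node. *)
have shift s : \sum_(k <- L) cn R n k * (TC k t * (phi k (node R n j))^*) =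
    \sum_(k <- L) cn R n k * (TC k t * (phi k (node R n (permv j s)))^*).
  rewrite -(perm_big _ (perm_L (s^-1)%g)) big_map; apply: eq_bigr => k _.
  rewrite cn_permv TC_permv !phi_node // -(dot_permv k (permv j s) (s^-1)%g).
  by rewrite permvM mulVg permv1.
have n24 : 24%:R != 0 :> R[i] by rewrite pnatr_eq0.
have c24 : #|{: 'S_4}| = 24%N by rewrite card_Sn.
transitivity (24%:R^-1 * \sum_(s : 'S_4) \sum_(k <- L)
    cn R n k * (TC k t * (phi k (node R n (permv j s)))^*)).
  rewrite (eq_bigr _ (fun s _ => esym (shift s))).
  by rewrite sumr_const c24 -[X in _ * X]mulr_natl mulKf.
rewrite exchange_big mulr_sumr; apply: eq_bigr => k _.
rewrite TC_node // rmorphM fmorphV rmorph_nat rmorph_sum /= -mulr_sumr -mulr_sumr.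
under [in RHS]eq_bigr => s _ do rewrite -phi_node //.
by ring.
Qed.

Theorem theorem4p7 (R : realType) (n : nat) (f : rvec R -> R[i]) :
  (0 < n)%N -> continuous_on_tri f ->
  [/\ inTCn n (Lstar n f),
      (forall j : ivec, inLambda n j -> Lstar n f (node R n j) = f (node R n j)),
      (forall g : rvec R -> R[i], inTCn n g ->
         (forall j : ivec, inLambda n j -> g (node R n j) = f (node R n j)) ->
         forall t : rvec R, inRH t -> g t = Lstar n f t)
    & (forall j : ivec, inLambda n j -> forall t : rvec R, inRH t ->
         ell_tri n j t = lambda R n j * Pplus (ell n j) t)].
Proof.
move=> n0 _; split.
- exact: Lstar_inTCn.
- by move=> j; apply: Lstar_node.
(* The reconstruction formula uses [g] only through its nodal values, which are those of [f]. *)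
- move=> g Hg gf t Ht; rewrite (TCn_reconstruct R n g t n0 Hg Ht) LstarE.
  by rewrite big_seq [RHS]big_seq; apply: eq_bigr => j; rewrite mem_Lambda_seq => /gf ->.
(* Once averaged, the summand is symmetric in [k], so the sum folds onto the alcove and [c_k]
   becomes [lambda_k]. *)
- move=> j Hj t Ht; rewrite Pplus_ell // sum_Hstar_average //.
  rewrite (sum_Hstar_alcove R n (fun k => TC k t * (TC k (node R n j))^*) n0).
    rewrite ell_triE -mulr_sumr mulrA; congr (_ * _).
    by apply: eq_bigr => k _; rewrite mulrA.
  by move=> k s; rewrite !TC_permv.
Qed.
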